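(* Let $G=(V,E,A)$ be an attributed graph equipped with a fixed proper vertex coloring $color(\cdot)$, and let $k$ be an integer. Then any weak fair clique of $G$ (with parameter $k$) is contained in the colorful $(k-1)$-core of $G$.
   Context: An attributed graph $G=(V,E,A)$ is a finite undirected, unweighted graph in which each vertex $u$ carries an attribute value $u.val$; $A_{val}=\{u.val : u\in V\}$ is the set of attribute values and $A_n=|A_{val}|$. $N(u)$ is the set of neighbors of $u$. The vertices of $G$ are colored so that no two adjacent vertices have the same color; $color(u)$ is the color of $u$. Subgraphs inherit the attribute values and colors from $G$. Weak fair clique: given an integer $k$, a clique $C$ of $G$ is a weak fair clique if (1) for each $a_i\in A_{val}$, the number of vertices of $C$ with attribute value $a_i$ is at least $k$; and (2) there is no clique $C'\supsetneq C$ satisfying (1). Colorful degree: for a subgraph $H$ of $G$, a vertex $u$ of $H$ and $a_i\in A_{val}$, $D_{a_i}(u,H)=|\{color(v) : v \text{ is a neighbor of } u \text{ in } H,\ v.val=a_i\}|$, and $D_{\min}(u,H)=\min\{D_{a_i}(u,H) : a_i\in A_{val}\}$. Colorful $k$-core: a subgraph $H=(V_H,E_H,A)$ of $G$ is a colorful $k$-core if (1) $D_{\min}(u,H)\ge k$ for each $u\in V_H$; and (2) there is no subgraph $H'\subseteq G$ satisfying (1) with $H\subsetneq H'$. *)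

(* Defs.v *)
From mathcomp Require Import all_boot all_order all_algebra.

Set Implicit Arguments.
Unset Strict Implicit.
Unset Printing Implicit Defensive.

Import Order.TTheory GRing.Theory Num.Theory.

(* A finite simple graph whose vertices are drawn from T.  An edge is an
   unordered pair of distinct vertices, i.e. a two-element set, so that graphs
   and their subgraphs have the same type and equality is extensional. *)
Record graph (T : finType) := Graph {
  gV : {set T};
  gE : {set {set T}};
  gE_wf : [forall e in gE, (e \subset gV) && (#|e| == 2)]
}.

Definition adj (T : finType) (H : graph T) (u v : T) : bool :=
  [set u; v] \in gE H.

Definition subgraph (T : finType) (H G : graph T) : bool :=
  (gV H \subset gV G) && (gE H \subset gE G).

Definition proper_subgraph (T : finType) (H G : graph T) : Prop :=
  subgraph H G /\ H <> G.

Definition proper_coloring (T : finType) (Col : eqType) (G : graph T)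
    (color : T -> Col) : Prop :=
  forall u v, adj G u v -> color u <> color v.

(* The values of [attr] and [color] outside [gV G] are never used.  [Aval] may
   list a value several times; only membership in it matters. *)
Definition Aval (T : finType) (A : eqType) (G : graph T) (attr : T -> A) :
    seq A :=
  [seq attr u | u in gV G].

Definition clique (T : finType) (G C : graph T) : Prop :=
  subgraph C G /\
  forall u v, u \in gV C -> v \in gV C -> u != v -> adj C u v.

Definition fair (T : finType) (A : eqType) (G : graph T) (attr : T -> A)
    (k : int) (C : graph T) : Prop :=
  forall a, a \in Aval G attr ->
    (k <= #|[set v in gV C | attr v == a]|%:Z)%R.

Definition weak_fair_clique (T : finType) (A : eqType) (G : graph T)
    (attr : T -> A) (k : int) (C : graph T) : Prop :=
  [/\ clique G C, fair G attr k C &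
      ~ exists C', [/\ clique G C', fair G attr k C' & proper_subgraph C C']].

Definition colorful_deg (T : finType) (A Col : eqType) (attr : T -> A)
    (color : T -> Col) (a : A) (u : T) (H : graph T) : nat :=
  size (undup [seq color v | v in [pred v | adj H u v & attr v == a]]).

(* The default of the iterated minimum is its term at [attr u], which belongs
   to [Aval G attr] whenever [u] is a vertex of G: for such u this is exactly
   the minimum over the (nonempty) set of attribute values of G. *)
Definition colorful_deg_min (T : finType) (A Col : eqType) (G : graph T)
    (attr : T -> A) (color : T -> Col) (u : T) (H : graph T) : nat :=
  \big[minn/colorful_deg attr color (attr u) u H]_(a <- Aval G attr)
     colorful_deg attr color a u H.

Definition min_colorful_deg_ge (T : finType) (A Col : eqType) (G : graph T)
    (attr : T -> A) (color : T -> Col) (k : int) (H : graph T) : Prop :=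
  forall u, u \in gV H -> (k <= (colorful_deg_min G attr color u H)%:Z)%R.

Definition colorful_core (T : finType) (A Col : eqType) (G : graph T)
    (attr : T -> A) (color : T -> Col) (k : int) (H : graph T) : Prop :=
  [/\ subgraph H G, min_colorful_deg_ge G attr color k H &
      ~ exists H', [/\ subgraph H' G, min_colorful_deg_ge G attr color k H' &
                       proper_subgraph H H']].

(* Main.v *)
Require Import Defs.
From mathcomp Require Import all_boot all_order all_algebra.
From mathcomp Require Import zify.

(** A larger subgraph has larger colorful degrees, so the vertex sets W whose
    induced subgraph G[W] has all its colorful degrees at least m are closed
    under union.  The union of all of them induces the greatest subgraph with
    that property, which is therefore the unique colorful m-core.  A clique C
    has the property for m = k - 1 as soon as each attribute value occurs k
    times in C: a vertex u of C is adjacent to all other vertices of C, and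
    these have pairwise distinct colors. *)

Set Implicit Arguments.
Unset Strict Implicit.
Unset Printing Implicit Defensive.

Section Subgraphs.
Variable T : finType.
Implicit Types (G H : graph T) (W : {set T}).

(** The field [gE_wf] is an equation between booleans, so all its proofs are equal and a graph is
    determined by its vertex and edge sets. *)
Lemma subgraph_anti H1 H2 : subgraph H1 H2 -> subgraph H2 H1 -> H1 = H2.
Proof.
case: H1 H2 => [V1 E1 wf1] [V2 E2 wf2] /andP[/= V12 E12] /andP[/= V21 E21].
have eqV : V1 = V2 by apply/eqP; rewrite eqEsubset V12.
have eqE : E1 = E2 by apply/eqP; rewrite eqEsubset E12.
by subst V2 E2; congr Graph; apply: bool_irrelevance.
Qed.

Lemma edge_subset H e : e \in gE H -> e \subset gV H.
Proof. by move/(forall_inP (gE_wf H))/andP=> []. Qed.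

Lemma induced_wf G W :
  [forall e in [set e in gE G | e \subset W],
    (e \subset gV G :&: W) && (#|e| == 2)].
Proof.
apply/forall_inP => e; rewrite inE => /andP[eG eW].
by have /andP[eV ->] := forall_inP (gE_wf G) e eG; rewrite subsetI eV eW.
Qed.

(** Cutting [W] down to [gV G] allows any set [W], with no side condition. *)
Definition induced G W : graph T := Graph (induced_wf G W).

Lemma induced_subgraph G W : subgraph (induced G W) G.
Proof.
by rewrite /subgraph subsetIl; apply/subsetP => e; rewrite inE => /andP[].
Qed.

Lemma induced_mono G W1 W2 :
  W1 \subset W2 -> subgraph (induced G W1) (induced G W2).
Proof.
move=> W12; rewrite /subgraph setIS //=; apply/subsetP => e.
by rewrite !inE => /andP[-> /subset_trans->].
Qed.

Lemma subgraph_induced H G W :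
  subgraph H G -> gV H \subset W -> subgraph H (induced G W).
Proof.
move=> /andP[VHG EHG] VHW; rewrite /subgraph subsetI VHG VHW /=.
apply/subsetP => e eH; rewrite inE (subsetP EHG) //=.
exact: subset_trans (edge_subset eH) VHW.
Qed.

End Subgraphs.

Section ColorfulDegree.
Variables (T : finType) (A Col : eqType) (G : graph T).
Variables (attr : T -> A) (color : T -> Col).
Implicit Types (H C : graph T) (m : int).

Lemma colorful_deg_mono a u H1 H2 : subgraph H1 H2 ->
  colorful_deg attr color a u H1 <= colorful_deg attr color a u H2.
Proof.
move=> /andP[_ E12]; apply: uniq_leq_size (undup_uniq _) _ => c.
rewrite !mem_undup => /imageP[v /andP[uv va] ->].
by apply: image_f; rewrite inE va andbT; apply: (subsetP E12).
Qed.

Lemma colorful_deg_min_mono u H1 H2 : subgraph H1 H2 ->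
  colorful_deg_min G attr color u H1 <= colorful_deg_min G attr color u H2.
Proof.
move=> H12; rewrite /colorful_deg_min.
apply: (big_ind2 leq) => [|????|a _]; [exact: colorful_deg_mono|lia|].
exact: colorful_deg_mono.
Qed.

Lemma colorful_deg_min_ge m u H : u \in gV G ->
  (forall a, a \in Aval G attr ->
     (m <= (colorful_deg attr color a u H)%:Z)%R) ->
  (m <= (colorful_deg_min G attr color u H)%:Z)%R.
Proof.
move=> uG le_m; rewrite /colorful_deg_min big_seq.
apply: (big_ind (fun d : nat => m <= d%:Z)%R) => [|??|a]; [|lia|exact: le_m].
(* The default of the minimum is the term at [attr u], an attribute value of [G] because [u] is a
   vertex. *)
by apply: le_m; apply: image_f.
Qed.

Lemma greatest_min_colorful_deg_ge m :
  exists U, [/\ subgraph U G, min_colorful_deg_ge G attr color m U &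
    forall H, subgraph H G -> min_colorful_deg_ge G attr color m H ->
      subgraph H U].
Proof.
(* A boolean form of [min_colorful_deg_ge], so that it can filter the finite union below. *)
pose good H :=
  [forall u in gV H, (m <= (colorful_deg_min G attr color u H)%:Z)%R].
pose W0 := \bigcup_(W : {set T} | good (induced G W)) W.
exists (induced G W0); split; first exact: induced_subgraph.
  move=> u; rewrite inE => /andP[uG /bigcupP[W goodW uW]].
  have uGW : u \in gV (induced G W) by rewrite inE uG.
  have WW0 : W \subset W0 by apply: bigcup_sup goodW.
  have := colorful_deg_min_mono u (induced_mono G WW0).
  by have := forall_inP goodW u uGW; lia.
(* [H] need not be induced, but it is a subgraph of [induced G (gV H)], which then meets the bound
   too; so [gV H] is one of the sets in the union [W0]. *)
move=> H HG degH; apply: subgraph_induced => //; apply: bigcup_sup.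
apply/forall_inP => u /setIP[_ uH]; apply: (Order.le_trans (degH u uH)).
exact: colorful_deg_min_mono (subgraph_induced HG (subxx (gV H))).
Qed.

(** The greatest subgraph is maximal, and any maximal one lies inside it, hence equals it. *)
Lemma colorful_core_exists_unique m :
  exists2 U, unique (colorful_core G attr color m) U &
    forall H, subgraph H G -> min_colorful_deg_ge G attr color m H ->
      subgraph H U.
Proof.
have [U [UG degU maxU]] := greatest_min_colorful_deg_ge m.
exists U => //; split.
  split=> // -[H [HG degH [UH neqUH]]]; apply: neqUH.
  exact: subgraph_anti UH (maxU H HG degH).
move=> H [HG degH maxH]; apply: subgraph_anti (maxU H HG degH).
have HU := maxU H HG degH.
case: (boolP (subgraph U H)) => // notUH; case: maxH; exists U; split=> //.
by split=> // eqHU; rewrite eqHU /subgraph !subxx in notUH.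
Qed.

(** The successor accounts for [u], which may carry the value [a] itself but is not its own
    neighbor. *)
Lemma clique_colorful_deg C a u : proper_coloring G color -> clique G C ->
  u \in gV C ->
  #|[set v in gV C | attr v == a]| <= (colorful_deg attr color a u C).+1.
Proof.
move=> properG [/andP[_ ECG] cliqueC] uC.
set B := [set v in gV C | _].
suff leB : #|B :\ u| <= colorful_deg attr color a u C.
  by have := cardsD1 u B; have := leq_b1 (u \in B); lia.
have BC v : v \in B :\ u -> [/\ v != u, v \in gV C & attr v == a].
  by rewrite !inE => /and3P[].
(* Distinct vertices of [C] are adjacent in [C], hence in [G], so their colors differ. *)
have color_inj : {in enum (B :\ u) &, injective color}.
  move=> v w; rewrite !mem_enum => /BC[_ vC _] /BC[_ wC _] eq_vw.
  case: (eqVneq v w) => // neq_vw.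
  by case: (properG v w) => //; apply: (subsetP ECG); apply: cliqueC.
rewrite cardE -(size_map color); apply: uniq_leq_size.
  by rewrite map_inj_in_uniq ?enum_uniq.
move=> c /mapP[v]; rewrite mem_enum => /BC[neq_vu vC va] ->.
by rewrite mem_undup; apply: image_f; rewrite inE va cliqueC // eq_sym.
Qed.

Lemma fair_clique_min_colorful_deg_ge (k : int) C :
  proper_coloring G color -> clique G C -> fair G attr k C ->
  min_colorful_deg_ge G attr color (k - 1)%R C.
Proof.
move=> properG cliqueC fairC u uC; have [/andP[VCG _] _] := cliqueC.
apply: colorful_deg_min_ge => [|a aG]; first exact: (subsetP VCG).
by have := clique_colorful_deg a properG cliqueC uC; have := fairC a aG; lia.
Qed.

End ColorfulDegree.

(** Speaking of the colorful core is justified by [unique]: it exists and is the only one. *)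
Theorem lemma1 (T : finType) (A Col : eqType) (G : graph T) (attr : T -> A)
    (color : T -> Col) (k : int) (color_proper : proper_coloring G color)
    (C : graph T) (C_fair : weak_fair_clique G attr k C) :
  exists2 H : graph T,
    unique (colorful_core G attr color (k - 1)%R) H & subgraph C H.
Proof.
have [cliqueC fairC _] := C_fair.
have [U coreU maxU] := colorful_core_exists_unique G attr color (k - 1)%R.
exists U => //; apply: maxU; first by case: cliqueC.
exact: fair_clique_min_colorful_deg_ge.
Qed.
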